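(* Let $N\ge3$, let $\mathcal W_N$ be the multiplicative $W$-algebra, i.e. the algebra of difference polynomials in $u_1,\dots,u_{N-1}$ with the two rational multiplicative Poisson $\lambda$-brackets determined, for $1\le i,j\le N-1$, by $$\{{u_i}_\lambda u_j\}_1=\big((\lambda S)^{-i}-\lambda^j\big)u_{i+j},$$ $$\{{u_i}_\lambda u_j\}_2=\Big(\sum_{n=1}^j-\sum_{n=i}^{i+j-1}\Big)u_n(\lambda S)^{n-i}u_{i+j-n}+u_j\frac{\big((\lambda S)^N-(\lambda S)^j\big)\big(1-(\lambda S)^{-i}\big)}{(\lambda S)^N-1}u_i,$$ where $u_N=1$ and $u_k=0$ for $k>N$. Consider the difference subalgebra $\mathcal A_N$ of the algebra $\mathcal W_N$ localized by $u_1$, generated by the elements $$v_1=\frac1{u_1\,S(u_1)\cdots S^{N-1}(u_1)},\qquad v_i=\frac{u_i}{u_1\,S(u_1)\cdots S^{i-1}(u_1)},\quad 2\le i\le N-1.$$ Then both multiplicative Poisson $\lambda$-brackets $\{\cdot\,_\lambda\,\cdot\}_1$ and $\{\cdot\,_\lambda\,\cdot\}_2$, restricted to the subalgebra $\mathcal A_N$, are local, i.e. $\{a_\lambda b\}_k\in\mathcal A_N[\lambda,\lambda^{-1}]$ for all $a,b\in\mathcal A_N$, $k=1,2$.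
   Context: The base field $\mathbb F$ has characteristic $0$. The algebra of difference polynomials in $u_1,\dots,u_{N-1}$ is $\mathbb F[S^n(u_i)\mid 1\le i\le N-1,\ n\in\mathbb Z]$ (polynomials in independent variables $S^n(u_i)$) with the shift automorphism $S$. A difference subalgebra is a subalgebra invariant under $S^{\pm1}$; ''localized by $u_1$'' means that all $S^n(u_1)$, $n\in\mathbb Z$, are inverted. A (non-local) multiplicative $\lambda$-bracket on a commutative algebra $\mathcal V$ with automorphism $S$ is a linear map $\mathcal V\otimes\mathcal V\to\mathcal V[[\lambda,\lambda^{-1}]]$ (bilateral series) satisfying $\{S(a)_\lambda b\}=\lambda^{-1}\{a_\lambda b\}$, $\{a_\lambda S(b)\}=\lambda S\{a_\lambda b\}$, $\{a_\lambda bc\}=\{a_\lambda b\}c+\{a_\lambda c\}b$ and $\{ab_\lambda c\}=\sum_n(p_nS^n(b)+q_nS^n(a))\lambda^n$ where $\{a_\lambda c\}=\sum_np_n\lambda^n$, $\{b_\lambda c\}=\sum_nq_n\lambda^n$. It is Poisson if moreover skewsymmetry ($\{b_\lambda a\}=-\sum_nS^{-n}(c_n)\lambda^{-n}$ if $\{a_\lambda b\}=\sum_nc_n\lambda^n$) and the Jacobi identity $\{a_\lambda\{b_\mu c\}\}-\{b_\mu\{a_\lambda c\}\}=\{\{a_\lambda b\}_{\lambda\mu}c\}$ hold. A bracket on a difference polynomial algebra is uniquely determined by its values on the generators, and it extends uniquely to localizations by the Leibniz rules. Convention: in expressions such as $u_n(\lambda S)^{m}u_k$, $S$ acts on what is written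 to its right, so it equals $u_nS^m(u_k)\lambda^m$. Rational functions $r(\lambda S)$ with $r\in\mathbb F(x)$ are replaced by the bilateral series $\frac12(r^+ + r^-)$, half the sum of the Laurent expansions of $r(x)$ at $x=0$ and at $x=\infty$, evaluated at $x=\lambda S$. *)

(* Defs.v *)
From HB Require Import structures.
From mathcomp Require Import all_boot all_order all_algebra.
From mathcomp Require Import fraction.
From mathcomp Require Import finmap.
From mathcomp.multinomials Require Import monalg.

Set Implicit Arguments.
Unset Strict Implicit.
Unset Printing Implicit Defensive.

Import Order.TTheory GRing.Theory Num.Theory.
Local Open Scope ring_scope.

Record diffAlg (F : fieldType) := DiffAlg {
  da_sort :> comUnitAlgType F;
  shift : {lrmorphism da_sort -> da_sort};
  unshift : da_sort -> da_sort;
  shiftK : cancel shift unshift;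
  unshiftK : cancel unshift shift }.

Definition shiftz (F : fieldType) (V : diffAlg F) (n : int) (a : V) : V :=
  match n with
  | Posz m => iter m (@shift F V) a
  | Negz m => iter m.+1 (@unshift F V) a
  end.

Inductive diffsubalg (F : fieldType) (V : diffAlg F) (G : V -> Prop)
  : V -> Prop :=
| Dsub_gen g : G g -> diffsubalg G g
| Dsub_one : diffsubalg G 1
| Dsub_scale c a : diffsubalg G a -> diffsubalg G (c *: a)
| Dsub_add a b : diffsubalg G a -> diffsubalg G b -> diffsubalg G (a + b)
| Dsub_mul a b : diffsubalg G a -> diffsubalg G b -> diffsubalg G (a * b)
| Dsub_shift n a : diffsubalg G a -> diffsubalg G (shiftz n a).

(* The indices 1 <= k <= N-1 of the generators u_k. *)
Definition gidx (N : nat) := {k : nat | (0 < k < N)%N}.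

(* The variable (i, n) stands for S^n(u_i). *)
Definition diffpoly (F : fieldType) (N : nat) :=
  {malg F[{cmonom (gidx N * int)%type}]}.
Definition dvar (F : fieldType) (N : nat) (i : gidx N) (n : int)
  : diffpoly F N := << ucm (i, n) >>.

(* The family u_k, k : nat, read in V through iota; by convention u_N = 1 and
   u_k = 0 for k > N (the value at k = 0 is junk). *)
Definition ugen (F : fieldType) (N : nat) (V : diffAlg F)
    (iota : diffpoly F N -> V) (k : nat) : V :=
  if (insub k : option (gidx N)) is Some i then iota (dvar F i 0)
  else (k == N)%:R.

(* (V, iota) is the difference algebra of difference polynomials in
   u_1, ..., u_(N-1), localized by u_1: iota is an injective algebra morphism
   intertwining the shifts, all S^n(u_1) become invertible, and every element
   of V is a fraction whose denominator is a product of elements S^n(u_1).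
   This determines (V, iota) up to a unique isomorphism. *)
Record localized_diffpoly (F : fieldType) (N : nat) (V : diffAlg F)
    (iota : {lrmorphism diffpoly F N -> V}) : Prop := {
  ldp_inj : injective iota;
  ldp_shift : forall i n, shift V (iota (dvar F i n)) = iota (dvar F i (n + 1));
  ldp_unit : forall n, shiftz n (ugen iota 1) \is a GRing.unit;
  ldp_frac : forall w : V, exists (p : diffpoly F N) (s : seq int),
    w = iota p / \prod_(n <- s) shiftz n (ugen iota 1) }.

(* A bilateral series sum_n c_n lambda^n is its family of coefficients
   c : int -> V, so that br a b n is the coefficient of lambda^n in
   {a_lambda b}. *)
Record lambda_bracket (F : fieldType) (V : diffAlg F)
    (br : V -> V -> int -> V) : Prop := {
  br_linl : forall c a a' b n, br (c *: a + a') b n = c *: br a b n + br a' b n;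
  br_linr : forall c a b b' n, br a (c *: b + b') n = c *: br a b n + br a b' n;
  br_shiftl : forall a b n, br (shift V a) b n = br a b (n + 1);
  br_shiftr : forall a b n, br a (shift V b) n = shift V (br a b (n - 1));
  br_leibnizl : forall a b c n, br a (b * c) n = br a b n * c + br a c n * b;
  br_leibnizr : forall a b c n,
    br (a * b) c n = br a c n * shiftz n b + br b c n * shiftz n a }.

(* The Jacobi identity is written coefficientwise, at lambda^m mu^n: if
   {a_lambda b} = sum_k c_k lambda^k, then
   {{a_lambda b}_(lambda mu) c} = sum_k lambda^k {c_k _(lambda mu) c},
   whose coefficient is that of (lambda mu)^n in {c_(m-n) _(lambda mu) c}. *)
Record poisson_lambda_bracket (F : fieldType) (V : diffAlg F)
    (br : V -> V -> int -> V) : Prop := {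
  br_lambda :> lambda_bracket br;
  br_skew : forall a b n, br b a n = - shiftz n (br a b (- n));
  br_jacobi : forall a b c m n,
    br a (br b c n) m - br b (br a c m) n = br (br a b (m - n)) c n }.

(* f is a bilateral series representing the rational function r: for each
   presentation r = p / q with p, q polynomials, q(x) f(x) = p(x). *)
Definition represents (F : fieldType) (r : {fraction {poly F}})
    (f : int -> F) : Prop :=
  forall p q : {poly F}, r * tofrac q = tofrac p ->
  forall n : int, \sum_(k < size q) q`_k * f (n - k%:Z)
                  = if n is Posz m then p`_m else 0.

Definition laurent_at_0 (F : fieldType) (r : {fraction {poly F}})
    (f : int -> F) : Prop :=
  represents r f /\ exists M : int, forall n, n < M -> f n = 0.

Definition laurent_at_infty (F : fieldType) (r : {fraction {poly F}})
    (f : int -> F) : Prop :=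
  represents r f /\ exists M : int, forall n, M < n -> f n = 0.

(* c = (r^+ + r^-) / 2 *)
Definition half_sum_expansion (F : fieldType) (r : {fraction {poly F}})
    (c : int -> F) : Prop :=
  exists rp rm : int -> F, [/\ laurent_at_0 r rp, laurent_at_infty r rm &
    forall n, c n = (rp n + rm n) / 2].

Section WAlgebra.
Variables (F : fieldType) (N : nat) (V : diffAlg F) (iota : diffpoly F N -> V).
Local Notation u := (ugen iota).

(* Coefficient of lambda^n in (lambda S)^m a. *)
Definition lS (m : int) (a : V) (n : int) : V :=
  if n == m then shiftz m a else 0.

(* Coefficient of lambda^n in lambda^m a. *)
Definition lmono (m : int) (a : V) (n : int) : V := if n == m then a else 0.

Definition W_bracket1 (br : V -> V -> int -> V) : Prop :=
  forall i j : nat, (0 < i < N)%N -> (0 < j < N)%N -> forall n : int,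
  br (u i) (u j) n = lS (- i%:Z) (u (i + j)) n - lmono j (u (i + j)) n.

Definition W_ratfun (i j : nat) : {fraction {poly F}} :=
  let x := tofrac 'X in
  (x ^+ N - x ^+ j) * (1 - x ^- i) / (x ^+ N - 1).

Definition W_bracket2 (br : V -> V -> int -> V) : Prop :=
  forall i j : nat, (0 < i < N)%N -> (0 < j < N)%N ->
  exists2 c : int -> F, half_sum_expansion (W_ratfun i j) c &
  forall n : int,
  br (u i) (u j) n =
    \sum_(1 <= k < j.+1) u k * lS (k%:Z - i%:Z) (u (i + j - k)) n
    - \sum_(i <= k < i + j) u k * lS (k%:Z - i%:Z) (u (i + j - k)) n
    + u j * (c n *: shiftz n (u i)).

Definition v_elt (i : nat) : V :=
  if i == 1%N then (\prod_(k < N) shiftz k (u 1))^-1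
  else u i / \prod_(k < i) shiftz k (u 1).

Definition A_alg : V -> Prop :=
  diffsubalg (fun g => exists2 i : nat, (0 < i < N)%N & g = v_elt i).

End WAlgebra.

(* {a_lambda b} is a Laurent polynomial with coefficients in A for all
   a, b in A. *)
Definition local_on (F : fieldType) (V : diffAlg F) (A : V -> Prop)
    (br : V -> V -> int -> V) : Prop :=
  forall a b, A a -> A b ->
  (forall n, A (br a b n)) /\
  exists M : nat, forall n : int, (M < `|n|)%N -> br a b n = 0.

(* Main.v *)
Require Import Defs.
From HB Require Import structures.
From mathcomp Require Import all_boot all_order all_algebra.
From mathcomp Require Import fraction zify ring.
From mathcomp.multinomials Require Import monalg.

Set Implicit Arguments.
Unset Strict Implicit.
Unset Printing Implicit Defensive.

Import Order.TTheory GRing.Theory Num.Theory.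
Local Open Scope ring_scope.

(* Put P_k = u_1 S(u_1) ... S^(k-1)(u_1) and w_k = u_k / P_k, so that w_1 = 1,
   w_N = v_1, w_k = v_k for 1 < k < N and w_k = 0 for k > N. By the Leibniz
   rules, if {u_i lambda u_j} = K_ij(lambda S) 1 and
   M_ij = P_j^-1 K_ij P_i^-1, then {w_i lambda w_j} is the operator
     M_ij - w_j (sum_(l < j) x^l) M_i1 - M_1j (sum_(k < i) x^-k) w_i
     + w_j (sum_(l < j) x^l) M_11 (sum_(k < i) x^-k) w_i,   x = lambda S,
   applied to 1. For both brackets M_ij is a Laurent polynomial in x with
   coefficients in A_N, plus, for the second one, w_j r_ij(x) w_i with
   r_ij = (x^N - x^j) (1 - x^-i) / (x^N - 1). Since
   1 - x^-i = (1 - x^-1) sum_(k < i) x^-k, one has r_ij = r_1j sum_(k < i) x^-k,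
   so the rational terms cancel. For v_1 one takes i = N, u_N = 1, where
   r_Nj = 1 - x^(j - N) is already a Laurent polynomial. *)

(** * Integer powers of the shift as algebra morphisms *)

Section Shiftz.
Variables (F : fieldType) (V : diffAlg F).
Implicit Types (a b : V) (m n : int).

Lemma shiftzS n a : shiftz (n + 1) a = shift V (shiftz n a).
Proof.
case: n => [n|[|n]]; first by rewrite -PoszD addn1.
  by rewrite /= unshiftK.
have -> : Negz n.+1 + 1 = Negz n by lia.
by rewrite /= unshiftK.
Qed.

Lemma shiftz_add m n a : shiftz (m + n) a = shiftz m (shiftz n a).
Proof.
elim/int_rect: m => [|m IH|m IH]; first by rewrite add0r.
  by rewrite -addn1 PoszD addrAC !shiftzS IH.
(* [unshift] is given only as an inverse of [shift], so negative exponents are reached by applying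
   the injective [shift] to both sides. *)
apply: (can_inj (@shiftK F V)); rewrite -!shiftzS.
have -> : - m.+1%:Z + n + 1 = - m%:Z + n by lia.
by have -> : - m.+1%:Z + 1 = - m%:Z by lia.
Qed.

Lemma shift_shiftzN (n : nat) a :
  shift V (shiftz (- n.+1%:Z) a) = shiftz (- n%:Z) a.
Proof. by rewrite -shiftzS; congr shiftz; lia. Qed.

Lemma shiftz_zmod_morphism n : zmod_morphism (@shiftz F V n).
Proof.
move=> a b; elim/int_rect: n => [|n IH|n IH] //.
  by rewrite -addn1 PoszD !shiftzS IH rmorphB.
apply: (can_inj (@shiftK F V)); rewrite rmorphB /=.
by rewrite !shift_shiftzN.
Qed.

Lemma shiftz_monoid_morphism n : monoid_morphism (@shiftz F V n).
Proof.
elim/int_rect: n => [|n [IH1 IHM]|n [IH1 IHM]] //.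
  by split=> [|a b]; rewrite -addn1 PoszD !shiftzS ?IH1 ?IHM ?rmorph1 ?rmorphM.
split=> [|a b]; apply: (can_inj (@shiftK F V)); rewrite ?rmorphM ?rmorph1 /=;
  by rewrite !shift_shiftzN.
Qed.

Lemma shiftz_scalable n : scalable (@shiftz F V n).
Proof.
move=> c a; elim/int_rect: n => [|n IH|n IH] //.
  by rewrite -addn1 PoszD !shiftzS IH linearZ.
apply: (can_inj (@shiftK F V)); rewrite linearZ /=.
by rewrite !shift_shiftzN.
Qed.

HB.instance Definition _ n :=
  GRing.isZmodMorphism.Build V V (@shiftz F V n) (shiftz_zmod_morphism n).
HB.instance Definition _ n :=
  GRing.isMonoidMorphism.Build V V (@shiftz F V n) (shiftz_monoid_morphism n).
HB.instance Definition _ n :=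
  GRing.isScalable.Build F V V *:%R (@shiftz F V n) (shiftz_scalable n).

End Shiftz.

Arguments shiftz : simpl never.

(** * Laurent polynomials over a difference subalgebra *)

Section LocalSeries.
Variables (F : fieldType) (V : diffAlg F) (G : V -> Prop).
Local Notation A := (diffsubalg G).
Implicit Types f g : int -> V.

(** This isolates what [local_on (diffsubalg G) br] demands of a single series [br a b]. *)
Definition local_series f : Prop :=
  (forall n, A (f n)) /\ exists M : nat, forall n : int, (M < `|n|)%N -> f n = 0.

Lemma diffsubalg0 : A 0.
Proof. by rewrite -(scale0r 1); apply/Dsub_scale/Dsub_one. Qed.

Lemma diffsubalgN a : A a -> A (- a).
Proof. by rewrite -scaleN1r; apply: Dsub_scale. Qed.

Lemma eq_local_series f g : f =1 g -> local_series g -> local_series f.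
Proof.
move=> fg [Ag [M gM]]; split=> [n|]; first by rewrite fg.
by exists M => n /gM; rewrite fg.
Qed.

Lemma local_series0 : local_series (fun=> 0).
Proof. by split=> [_|]; [exact: diffsubalg0 | exists 0%N]. Qed.

Lemma local_series_delta m a :
  A a -> local_series (fun n => if n == m then a else 0).
Proof.
move=> Aa; split=> [n|]; first by case: ifP => // _; apply: diffsubalg0.
by exists `|m|%N => n; case: eqP => // ->; rewrite ltnn.
Qed.

Lemma local_seriesD f g : local_series f -> local_series g ->
  local_series (fun n => f n + g n).
Proof.
move=> [Af [M fM]] [Ag [M' gM]]; split=> [n|]; first exact: Dsub_add.
exists (M + M')%N => n lt_n; rewrite fM ?gM ?addr0 //.
  by apply: leq_ltn_trans lt_n; rewrite leq_addl.
by apply: leq_ltn_trans lt_n; rewrite leq_addr.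
Qed.

Lemma local_seriesM f g : local_series f -> (forall n, A (g n)) ->
  local_series (fun n => f n * g n).
Proof.
move=> [Af [M fM]] Ag; split=> [n|]; first exact: Dsub_mul.
by exists M => n /fM ->; rewrite mul0r.
Qed.

Lemma local_seriesN f : local_series f -> local_series (fun n => - f n).
Proof.
move=> [Af [M fM]]; split=> [n|]; first exact: diffsubalgN.
by exists M => n /fM ->; rewrite oppr0.
Qed.

Lemma local_seriesZ c f : local_series f -> local_series (fun n => c *: f n).
Proof.
move=> [Af [M fM]]; split=> [n|]; first exact: Dsub_scale.
by exists M => n /fM ->; rewrite scaler0.
Qed.

Lemma local_series_sum (I : Type) (r : seq I) (P : pred I) (f : I -> int -> V) :
  (forall i, P i -> local_series (f i)) ->
  local_series (fun n => \sum_(i <- r | P i) f i n).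
Proof.
move=> f_loc; elim: r => [|i r IH].
  by apply: eq_local_series local_series0 => n; rewrite big_nil.
have [Pi|Pi] := boolP (P i).
  apply: eq_local_series (local_seriesD (f_loc i Pi) IH) => n.
  by rewrite big_cons Pi.
by apply: eq_local_series IH => n; rewrite big_cons (negPf Pi).
Qed.

Lemma local_series_index m f :
  local_series f -> local_series (fun n => f (n + m)).
Proof.
move=> [Af [M fM]]; split=> // ; exists (M + `|m|)%N => n lt_n.
by apply: fM; lia.
Qed.

Lemma local_series_shiftz m f :
  local_series f -> local_series (fun n => shiftz m (f n)).
Proof.
move=> [Af [M fM]]; split=> [n|]; first exact: Dsub_shift.
by exists M => n /fM ->; rewrite rmorph0.
Qed.

End LocalSeries.

(** * Extension of locality from generators to the whole subalgebra *)

Section LambdaBracket.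
Variables (F : fieldType) (V : diffAlg F) (br : V -> V -> int -> V).
Hypothesis brP : lambda_bracket br.
Implicit Types (a b x : V) (n m : int).

Lemma br0r a n : br a 0 n = 0.
Proof.
have := br_linr brP 1 a 0 0 n; rewrite !scale1r addr0.
by move/eqP; rewrite -subr_eq subrr eq_sym => /eqP.
Qed.

Lemma br0l a n : br 0 a n = 0.
Proof.
have := br_linl brP 1 0 0 a n; rewrite !scale1r addr0.
by move/eqP; rewrite -subr_eq subrr eq_sym => /eqP.
Qed.

Lemma br1r a n : br a 1 n = 0.
Proof.
have := br_leibnizl brP a 1 1 n; rewrite !mulr1.
by move/eqP; rewrite -subr_eq subrr eq_sym => /eqP.
Qed.

Lemma br1l a n : br 1 a n = 0.
Proof.
have := br_leibnizr brP 1 1 a n; rewrite rmorph1 !mulr1.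
by move/eqP; rewrite -subr_eq subrr eq_sym => /eqP.
Qed.

Lemma br_shiftzr m a b n : br a (shiftz m b) n = shiftz m (br a b (n - m)).
Proof.
elim/int_rect: m n => [|m IH|m IH] n; first by rewrite subr0.
  by rewrite -addn1 PoszD !shiftzS br_shiftr // IH opprD addrA addrAC.
apply: (can_inj (@shiftK F V)); rewrite -shiftzS.
have -> : n - - m.+1%:Z = n + 1 - - m%:Z by lia.
have -> : - m.+1%:Z + 1 = - m%:Z by lia.
rewrite -IH -[in RHS](_ : - m.+1%:Z + 1 = - m%:Z); last by lia.
by rewrite shiftzS br_shiftr // addrK.
Qed.

Lemma br_shiftzl m a b n : br (shiftz m a) b n = br a b (n + m).
Proof.
elim/int_rect: m n => [|m IH|m IH] n; first by rewrite addr0.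
  by rewrite -addn1 PoszD !shiftzS br_shiftl // IH -addrA [1 + _]addrC.
have -> : n - m.+1%:Z = n - 1 - m%:Z by lia.
rewrite -IH -[in RHS](_ : - m.+1%:Z + 1 = - m%:Z); last by lia.
by rewrite shiftzS br_shiftl // subrK.
Qed.

(** Each constructor of [diffsubalg] is matched by a bracket axiom. The induction on [b] comes
    first, for generators [a]; the induction on [a] then starts from it. The factors [shiftz n] in
    the left Leibniz rule stay in the subalgebra, which is closed under shifts. *)
Lemma local_on_diffsubalg (G : V -> Prop) :
  (forall a b, G a -> G b -> local_series G (br a b)) ->
  local_on (diffsubalg G) br.
Proof.
move=> G_loc a b Aa Ab.
have {G_loc} : forall a, G a -> local_series G (br a b).
  move=> {Aa}a Ga; elim: Ab => {b} [b Gb||c b _ IH|b c _ IHb _ IHc||m b _ IH].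
  - exact: G_loc.
  - by apply: eq_local_series (local_series0 G) => n; rewrite br1r.
  - apply: eq_local_series (local_seriesZ c IH) => n.
    by rewrite -[c *: b]addr0 br_linr // br0r addr0.
  - apply: eq_local_series (local_seriesD IHb IHc) => n.
    by rewrite -[b]scale1r br_linr // !scale1r.
  - move=> b c Ab IHb Ac IHc.
    apply: eq_local_series
      (local_seriesD (local_seriesM IHb (fun=> Ac)) (local_seriesM IHc (fun=> Ab))).
    by move=> n; rewrite br_leibnizl.
  - apply: eq_local_series (local_series_shiftz m (local_series_index (- m) IH)).
    by move=> n; rewrite br_shiftzr.
move=> G_loc; elim: Aa => {a} [a Ga||c a _ IH|a c _ IHa _ IHc||m a _ IH].
- exact: G_loc.
- by apply: eq_local_series (local_series0 G) => n; rewrite br1l.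
- apply: eq_local_series (local_seriesZ c IH) => n.
  by rewrite -[c *: a]addr0 br_linl // br0l addr0.
- apply: eq_local_series (local_seriesD IHa IHc) => n.
  by rewrite -[a]scale1r br_linl // !scale1r.
- move=> a c Aa IHa Ac IHc.
  apply: eq_local_series (local_seriesD
    (local_seriesM IHa (fun n => Dsub_shift n Ac))
    (local_seriesM IHc (fun n => Dsub_shift n Aa))).
  by move=> n; rewrite br_leibnizr.
- apply: eq_local_series (local_series_index m IH) => n.
  by rewrite br_shiftzl.
Qed.

End LambdaBracket.

(** * Products of shifts, their logarithmic derivatives and quotient rules *)

Section ShiftProd.
Variables (F : fieldType) (V : diffAlg F) (x : V).
Hypothesis x_unit : x \is a GRing.unit.

(** This is [P_i] of the outline when [x = u_1]. *)
Definition shift_prod (i : nat) : V := \prod_(k < i) shiftz k x.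

Lemma shift_prod_unit i : shift_prod i \is a GRing.unit.
Proof. by apply: rpred_prod => k _; apply: rmorph_unit. Qed.

Lemma shift_prod1 : shift_prod 1 = x.
Proof. by rewrite /shift_prod big_ord1. Qed.

Lemma shift_prodS i : shift_prod i.+1 = shift_prod i * shiftz i x.
Proof. by rewrite /shift_prod big_ord_recr. Qed.

Lemma shift_prodD i j :
  shift_prod (i + j) = shift_prod i * shiftz i (shift_prod j).
Proof.
rewrite /shift_prod big_split_ord rmorph_prod; congr (_ * _).
by apply: eq_bigr => k _; rewrite /= -shiftz_add.
Qed.

(* After substituting u_k = P_k w_k, this turns u_k (lambda S)^(k-i) u_(i+j-k)
   into P_j w_k (lambda S)^(k-i) w_(i+j-k) P_i, with outer factors that do not
   depend on k. *)
Lemma shift_prod_exchange i j k : (k <= i + j)%N ->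
  shift_prod k * shiftz (k%:Z - i%:Z) (shift_prod (i + j - k))
  = shift_prod j * shiftz (k%:Z - i%:Z) (shift_prod i).
Proof.
move=> le_k; have [le_kj|/ltnW le_jk] := leqP k j.
  rewrite -addnBA // shift_prodD rmorphM /= -shiftz_add subrK.
  by rewrite mulrCA -shift_prodD subnKC // mulrC.
have -> : shift_prod i
    = shift_prod (i + j - k) * shiftz (i + j - k)%N (shift_prod (k - j)).
  by rewrite -shift_prodD; congr shift_prod; lia.
rewrite rmorphM /= -shiftz_add.
have -> : k%:Z - i%:Z + (i + j - k)%N = j by lia.
by rewrite mulrCA -shift_prodD subnKC // mulrC.
Qed.

Variable br : V -> V -> int -> V.
Hypothesis brP : lambda_bracket br.

(** A logarithmic derivative: the factor [S^l(x)] contributes [(lambda S)^l] applied to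
    [{a_lambda x} / x]. *)
Lemma br_shift_prodr a j n : br a (shift_prod j) n / shift_prod j
  = \sum_(l < j) shiftz l (br a x (n - l%:Z) / x).
Proof.
elim: j => [|j IH].
  by rewrite big_ord0 /shift_prod big_ord0 br1r // mul0r.
rewrite big_ord_recr /= -IH shift_prodS br_leibnizl // br_shiftzr //.
have Uj := shift_prod_unit j; have Ux : shiftz j x \is a GRing.unit.
  exact: rmorph_unit.
rewrite rmorphM rmorphV //= mulrDl invrM //; congr (_ + _).
  by rewrite [_^-1 * _]mulrC mulrACA divrr // mulr1.
by rewrite mulrACA divrr // mulr1.
Qed.

(** The left counterpart. Here the division acts before the operator, hence is shifted by [n] at
    [lambda^n]; the factor [S^k(x)] multiplies the series by [lambda^-k], so the coefficient at
    [n + k] is read. *)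
Lemma br_shift_prodl i c n : br (shift_prod i) c n * shiftz n (shift_prod i)^-1
  = \sum_(k < i) br x c (n + k%:Z) * shiftz (n + k%:Z) x^-1.
Proof.
elim: i => [|i IH].
  by rewrite big_ord0 /shift_prod big_ord0 br1l // mul0r.
have Ui := shift_prod_unit i; have Ux : shiftz i x \is a GRing.unit.
  exact: rmorph_unit.
rewrite big_ord_recr /= -IH shift_prodS br_leibnizr // br_shiftzl //.
have -> : shiftz (n + i%:Z) x^-1 = shiftz n (shiftz i x)^-1.
  by rewrite shiftz_add -rmorphV.
rewrite invrM // rmorphM /= mulrDl; congr (_ + _).
  by rewrite [shiftz n _ * _]mulrC mulrACA -rmorphM /= divrr // rmorph1 mulr1.
by rewrite mulrACA -rmorphM /= divrr // rmorph1 mulr1.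
Qed.

(** The Leibniz rule for [b = (b / P_j) P_j], solved for the bracket with the quotient; [br_divl] is
    obtained in the same way. *)
Lemma br_divr a b j n : br a (b / shift_prod j) n =
  br a b n / shift_prod j
  - (b / shift_prod j) * \sum_(l < j) shiftz l (br a x (n - l%:Z) / x).
Proof.
have Uj := shift_prod_unit j.
have := br_leibnizl brP a (b / shift_prod j) (shift_prod j) n.
rewrite divrK // -br_shift_prodr => ->.
by rewrite mulrDl mulrK // -mulrA mulrCA addrK.
Qed.

Lemma br_divl a i c n : br (a / shift_prod i) c n =
  br a c n * shiftz n (shift_prod i)^-1
  - shiftz n (a / shift_prod i)
    * \sum_(k < i) br x c (n + k%:Z) * shiftz (n + k%:Z) x^-1.
Proof.
have Ui := shift_prod_unit i.
have := br_leibnizr brP (a / shift_prod i) (shift_prod i) c n.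
rewrite divrK // -br_shift_prodl => ->.
rewrite mulrDl -mulrA -rmorphM divrr // rmorph1 mulr1.
by rewrite [X in _ + X - _]mulrAC [X in _ - X]mulrC addrK.
Qed.

End ShiftProd.

(** * Cancellation of nonlocal terms for the normalized generators *)

(* The nonlocal part of {u_i lambda u_j} is u_j r_ij(lambda S) u_i, and d j is
   the series of r_1j. That the series of r_ij is sum_(k < i) x^(-k) d j, for
   i = N as well, is what makes the nonlocal terms cancel. *)
Section NormalizedGenerators.
Variables (F : fieldType) (V : diffAlg F) (G : V -> Prop).
Variables (N : nat) (u : nat -> V).
Hypotheses (N_gt1 : (1 < N)%N) (u1_unit : u 1%N \is a GRing.unit).
Hypothesis uN : u N = 1.
Local Notation P := (shift_prod (u 1%N)).
Local Notation w := (fun i => u i / P i).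
Hypothesis w_in : forall k, (0 < k)%N -> diffsubalg G (w k).
Variables (br : V -> V -> int -> V) (brP : lambda_bracket br).
Variables (L : nat -> nat -> int -> V) (d : nat -> int -> F).
Hypothesis L_loc : forall i j, (0 < i < N)%N -> (0 < j < N)%N ->
  local_series G (L i j).
Hypothesis br_u : forall i j, (0 < i < N)%N -> (0 < j < N)%N -> forall n,
  br (u i) (u j) n * shiftz n (P i)^-1 / P j
  = L i j n + (\sum_(k < i) d j (n + k%:Z)) *: (w j * shiftz n (w i)).
Hypothesis dN_fin : forall j, (0 < j < N)%N -> exists M : nat, forall n : int,
  (M < `|n|)%N -> \sum_(k < N) d j (n + k%:Z) = 0.

Lemma normalized1 : w 1%N = 1.
Proof. by rewrite /= shift_prod1 divrr. Qed.

(** Normalizing the left argument already removes the nonlocality: for [i < N] the sum subtracted by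
    [br_divl] carries the same nonlocal term as [br_u]. For [i = N] the bracket of [u_N = 1] is
    zero, and the remaining term is finite by [dN_fin]. *)
Lemma br_normalizedl_local i j : (0 < i <= N)%N -> (0 < j <= N)%N ->
  local_series G (fun n => br (w i) (u j) n / P j).
Proof.
move=> iN; rewrite (leq_eqVlt j) andb_orr => /orP[/andP[j0 /eqP ->]|jN].
  by apply: eq_local_series (local_series0 G) => n; rewrite uN br1r // mul0r.
have [i0 _] := andP iN; have [j0 _] := andP jN.
have br_w n : br (w i) (u j) n / P j
    = br (u i) (u j) n * shiftz n (P i)^-1 / P j
      - shiftz n (w i) * (\sum_(k < i) L 1%N j (n + k%:Z)
                          + (\sum_(k < i) d j (n + k%:Z)) *: w j).
  rewrite (br_divl u1_unit brP) mulrBl -[X in _ - X = _]mulrA mulr_suml scaler_suml -big_split /=.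
  congr (_ - _ * _); apply: eq_bigr => k _.
  (* Since [w 1 = 1], the nonlocal part of each summand is just [d j (n + k)] times [w j]. *)
  have := br_u (N_gt1 : (0 < 1 < N)%N) jN (n + k%:Z).
  by rewrite normalized1 rmorph1 mulr1 big_ord1 addr0 shift_prod1.
have L1_loc : local_series G (fun n => - (\sum_(k < i) L 1%N j (n + k%:Z)
                                          * shiftz n (w i))).
  apply: local_seriesN; apply: local_series_sum => k _.
  apply: local_seriesM => [|n]; last by apply/Dsub_shift/w_in.
  by apply: local_series_index; apply: L_loc.
have [ltiN|leNi] := ltnP i N.
  have iN' : (0 < i < N)%N by rewrite i0.
  apply: eq_local_series (local_seriesD (L_loc iN' jN) L1_loc) => n.
  rewrite br_w br_u // mulrDr -scalerAr [shiftz n (w i) * w j]mulrC opprD.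
  by rewrite [- _ - _]addrC addrA addrK -mulr_suml mulrC.
have eiN : i = N by apply/eqP; rewrite eqn_leq leNi andbT; case/andP: iN.
have dw_loc : local_series G (fun n =>
    (\sum_(k < i) d j (n + k%:Z)) *: w j * shiftz n (w i)).
  apply: local_seriesM => [|n]; last by apply/Dsub_shift/w_in.
  split=> [n|]; first by apply/Dsub_scale/w_in.
  have [M dM] := dN_fin jN; exists M => n /dM.
  by rewrite eiN => ->; rewrite scale0r.
apply: eq_local_series (local_seriesD L1_loc (local_seriesN dw_loc)) => n.
rewrite br_w {1}eiN uN br1l // !mul0r add0r mulrDr opprD -mulr_suml.
by congr (- _ - _); rewrite mulrC.
Qed.

(** The two terms of [br_divr] are built from the half-normalized series at [j] and at [1], so both
    are local separately. *)
Lemma br_normalized_local i j : (0 < i <= N)%N -> (0 < j <= N)%N ->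
  local_series G (br (w i) (w j)).
Proof.
move=> iN jN; have [j0 _] := andP jN.
have X1_loc : local_series G (fun n => \sum_(l < j)
    shiftz l (br (w i) (u 1%N) (n - l%:Z) / u 1%N)).
  apply: local_series_sum => l _; apply: local_series_shiftz.
  apply: (@local_series_index _ _ _ _ (fun n => br (w i) (u 1%N) n / u 1%N)).
  apply: eq_local_series (br_normalizedl_local iN (ltnW N_gt1 : (0 < 1 <= N)%N)).
  by move=> n; rewrite [X in _ = _ / X]shift_prod1.
apply: eq_local_series (local_seriesD (br_normalizedl_local iN jN)
  (local_seriesN (local_seriesM X1_loc (fun=> w_in j0)))) => n.
by rewrite (br_divr u1_unit brP) [w j * _]mulrC.
Qed.

End NormalizedGenerators.

(** * Expansions of the rational coefficients *)

Lemma W_ratfun_identity (K : fieldType) (a b c : K) : a - 1 != 0 -> c != 0 ->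
  (a - b) * (1 - c^-1) / (a - 1) * (a * c - c) = a * c - a - b * c + b.
Proof. by move=> a1 c0; field; apply/andP. Qed.

Section RationalPart.
Variables (F : fieldType) (N : nat).
Hypothesis N_gt0 : (0 < N)%N.
Implicit Types (f : int -> F) (n : int).

(** This gives uniqueness of the expansion at 0: two series with the same product by [x^N - 1]
    differ by an [N]-periodic one. *)
Lemma periodic_eq0_below f : (forall n, f (n - N%:Z) = f n) ->
  (exists M : int, forall n, n < M -> f n = 0) -> forall n, f n = 0.
Proof.
move=> f_per [M fM] n.
have f_perM k : f (n - (k * N)%N%:Z) = f n.
  elim: k => [|k <-]; first by rewrite mul0n subr0.
  by rewrite -[RHS]f_per; congr f; lia.
(* As [N > 0], this many periods carry [n] below [M]. *)
by rewrite -(f_perM (`|n| + `|M|).+1) fM //; nia.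
Qed.

Lemma periodic_eq0_above f : (forall n, f (n - N%:Z) = f n) ->
  (exists M : int, forall n, M < n -> f n = 0) -> forall n, f n = 0.
Proof.
move=> f_per [M fM] n; rewrite -[n]opprK.
apply: (@periodic_eq0_below (fun m => f (- m))) => [m|].
  by rewrite -[LHS]f_per; congr f; lia.
by exists (- M) => m ltm; apply: fM; lia.
Qed.

(** The denominator [x^i (x^N - 1)] also clears [x^-i], so this presentation is a quotient of
    polynomials and [represents] becomes a recurrence. *)
Lemma W_ratfun_represents i j f : represents (W_ratfun F N i j) f -> forall n,
  f (n - (N + i)%N%:Z) - f (n - i%:Z)
  = (n == (N + i)%N%:Z)%:R - (n == N%:Z)%:R - (n == (j + i)%N%:Z)%:R
    + (n == j%:Z)%:R.
Proof.
pose q : {poly F} := 'X^(N + i) - 'X^i.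
pose p : {poly F} := 'X^(N + i) - 'X^N - 'X^(j + i) + 'X^j.
move=> /(_ p q) + n; have -> : W_ratfun F N i j * tofrac q = tofrac p.
  rewrite /W_ratfun; set x := tofrac 'X.
  have XnE k : tofrac ('X^k : {poly F}) = x ^+ k by rewrite /x rmorphXn.
  have x0 : x != 0 by rewrite tofrac_eq0 polyX_eq0.
  have xN : x ^+ N - 1 != 0.
    rewrite -XnE -tofrac1 -tofracN -tofracD tofrac_eq0 -size_poly_eq0.
    by rewrite -[1]/(1%:P) size_XnsubC.
  rewrite /p /q !(tofracD, tofracN) 2!XnE (XnE N) (XnE (j + i)%N) (XnE j).
  rewrite !exprD; move: x0 xN; move: x XnE => x _ x0 xN.
  have xi : x ^+ i != 0 by rewrite expf_eq0 (negPf x0) andbF.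
  move: (x ^+ N) (x ^+ i) (x ^+ j) xN xi => a c b a1 c0.
  exact: W_ratfun_identity a1 c0.
move=> /(_ erefl n).
have sz_q : size q = (N + i).+1.
  by rewrite size_polyDl ?size_polyXn // size_polyN size_polyXn; lia.
have pick (a : nat) : (a < size q)%N ->
    \sum_(k < size q) (val k == a)%:R * f (n - k%:Z) = f (n - a%:Z).
  move=> lt_a; rewrite (bigD1 (Ordinal lt_a)) //= eqxx mul1r big1 ?addr0 //.
  by move=> k; rewrite -val_eqE /= => /negPf ->; rewrite mul0r.
under eq_bigr do rewrite coefB !coefXn mulrBl.
rewrite sumrB !pick ?sz_q; [|by lia..].
by case: n {pick} => n ->; rewrite ?subr0 ?addr0 // /p !(coefD, coefN) !coefXn.
Qed.

(** The witness [e] is the half sum for [1 / (x^N - 1)], and [c] is [(x^N - x^j) (1 - x^-i)] times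
    it. A single [e] serves all [i] and [j], which later permits telescoping in [i]. *)
Lemma W_ratfun_half_sum : [pchar F] =i pred0 -> exists e : int -> F,
  (forall n, e (n - N%:Z) - e n = (n == 0)%:R) /\
  forall i j c, half_sum_expansion (W_ratfun F N i j) c -> forall n,
    c n = e (n - N%:Z) - e (n - j%:Z)
          - e (n - N%:Z + i%:Z) + e (n - j%:Z + i%:Z).
Proof.
move=> charF0.
(* The expansions of 1 / (x^N - 1) at 0 and at infinity. *)
pose ep n : F := - ((0 <= n) && (N %| `|n|)%N)%:R.
pose em n : F := ((n < 0) && (N %| `|n|)%N)%:R.
have dvdB n : (N %| `|(n - N%:Z)%R|)%N = (N %| `|n|)%N.
  rewrite -[LHS]/(N%:Z %| n - N%:Z)%Z -[RHS]/(N%:Z %| n)%Z.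
  by rewrite rpredBr ?dvdzz.
have epP n : ep (n - N%:Z) - ep n = (n == 0)%:R.
  rewrite /ep dvdB; have [->|n0] := eqVneq n 0; first last.
    case: (boolP (N %| `|n|)%N) => [/dvdn_leq|_]; last by rewrite !andbF subrr.
    rewrite absz_gt0 => /(_ n0) leNn; have -> : (0 <= n - N%:Z) = (0 <= n) by lia.
    by rewrite subrr.
  have -> : (0 <= 0 - N%:Z) = false by lia.
  by rewrite dvdn0 oppr0 sub0r opprK.
have emP n : em (n - N%:Z) - em n = (n == 0)%:R.
  rewrite /em dvdB; have [->|n0] := eqVneq n 0; first last.
    case: (boolP (N %| `|n|)%N) => [/dvdn_leq|_]; last by rewrite !andbF subrr.
    rewrite absz_gt0 => /(_ n0) leNn; have -> : (n - N%:Z < 0) = (n < 0) by lia.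
    by rewrite subrr.
  have -> : (0 - N%:Z < 0) = true by lia.
  by rewrite dvdn0 subr0.
pose comb (e : int -> F) i j n := e (n - N%:Z) - e (n - j%:Z)
          - e (n - N%:Z + i%:Z) + e (n - j%:Z + i%:Z).
(* Multiplication by [x^N - 1] sends [f] and [comb e i j] to the same Laurent polynomial, so their
   difference is periodic. *)
have comb_per e f i j : (forall n, e (n - N%:Z) - e n = (n == 0)%:R) ->
    represents (W_ratfun F N i j) f ->
    forall n, f (n - N%:Z) - comb e i j (n - N%:Z) = f n - comb e i j n.
  move=> eP /W_ratfun_represents fP n.
  have := fP (n + i%:Z).
  have -> : n + i%:Z - (N + i)%N%:Z = n - N%:Z by lia.
  rewrite addrK => /eqP; rewrite subr_eq => /eqP ->.
  have eP' m : e (m - N%:Z) = (m == 0)%:R + e m by rewrite -(eP m) subrK.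
  rewrite /comb.
  have -> : n - N%:Z - j%:Z = n - j%:Z - N%:Z by lia.
  have -> : n - N%:Z - N%:Z + i%:Z = n - N%:Z + i%:Z - N%:Z by lia.
  have -> : n - j%:Z - N%:Z + i%:Z = n - j%:Z + i%:Z - N%:Z by lia.
  rewrite (eP' (n - N%:Z)) (eP' (n - j%:Z)) (eP' (n - N%:Z + i%:Z)).
  rewrite (eP' (n - j%:Z + i%:Z)).
  have -> : (n + i == (N + i)%N%:Z) = (n - N%:Z == 0) by lia.
  have -> : (n + i == N%:Z) = (n - N%:Z + i%:Z == 0) by lia.
  have -> : (n + i == (j + i)%N%:Z) = (n - j%:Z == 0) by lia.
  have -> : (n + i == j%:Z) = (n - j%:Z + i%:Z == 0) by lia.
  by ring.
have two_neq0 : 2 != 0 :> F by rewrite ((pcharf0P F).1 charF0).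
exists (fun n => (ep n + em n) / 2); split=> [n|i j c [rp [rm]]].
  rewrite -mulrBl opprD addrACA epP emP.
  by rewrite -mulr2n -[_ *+ 2]mulr_natr mulfK.
move=> [[rpP [Mp rpM]] [rmP [Mm rmM]] cE] n.
have -> : c n = (comb ep i j n + comb em i j n) / 2.
  rewrite cE; congr ((_ + _) / 2); apply/eqP; rewrite -subr_eq0; apply/eqP.
    apply: (periodic_eq0_below (comb_per _ _ _ _ epP rpP)).
    (* Below this bound [rp] vanishes and all four arguments of [ep] are negative, even those raised
       by [i]. *)
    exists (- (`|Mp| + i)%N%:Z) => m ltm; rewrite rpM; last by lia.
    have ep0 k : k < 0 -> ep k = 0 by rewrite /ep ltNge => /negPf ->; rewrite oppr0.
    by rewrite /comb !ep0 ?subr0 ?addr0 ?subr0 //; lia.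
  apply: (periodic_eq0_above (comb_per _ _ _ _ emP rmP)).
  exists (`|Mm| + N + j)%N%:Z => m ltm; rewrite rmM; last by lia.
  have em0 k : 0 <= k -> em k = 0 by rewrite /em leNgt => /negPf ->.
  by rewrite /comb !em0 ?subr0 ?addr0 ?subr0 //; lia.
by rewrite /comb; ring.
Qed.

End RationalPart.

(** * Locality of the two brackets of the W-algebra *)

Section WGenerators.
Variables (F : fieldType) (N : nat) (V : diffAlg F).
Variable iota : {lrmorphism diffpoly F N -> V}.
Hypotheses (N_gt1 : (1 < N)%N) (V_loc : localized_diffpoly iota).
Local Notation u := (ugen iota).
Local Notation P := (shift_prod (u 1%N)).
Local Notation w := (fun i => u i / P i).

Lemma ugen_ge k : (N <= k)%N -> u k = (k == N)%:R.
Proof. by move=> leNk; rewrite /ugen insubF // [(k < N)%N]ltnNge leNk andbF. Qed.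

Lemma ugenN : u N = 1.
Proof. by rewrite ugen_ge ?eqxx. Qed.

Lemma ugen1_unit : u 1%N \is a GRing.unit.
Proof. exact: ldp_unit V_loc 0. Qed.

(** Covering every [k > 0], beyond [N] too, spares a case distinction on indices such as [i + j]. *)
Lemma A_alg_normalized k : (0 < k)%N -> A_alg iota (w k).
Proof.
have in_A i : (0 < i < N)%N -> A_alg iota (v_elt iota i).
  by move=> iN; apply: Dsub_gen; exists i.
case: k => [|[|k]] // _.
  by rewrite /= shift_prod1 divrr ?ugen1_unit //; apply: Dsub_one.
have [ltkN|] := ltnP k.+2 N; first exact: (in_A k.+2).
rewrite leq_eqVlt => /orP[/eqP <-|ltNk].
  by rewrite ugenN mul1r; apply: (in_A 1%N).
rewrite ugen_ge ?[_ == N]gtn_eqF ?mul0r //; last exact: ltnW.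
exact: diffsubalg0.
Qed.

Lemma v_elt_normalized i : (0 < i < N)%N ->
  exists2 k, (0 < k <= N)%N & v_elt iota i = w k.
Proof.
case/andP=> i0 iN; rewrite /v_elt; have [_|i1] := eqVneq i 1%N.
  exists N; first by rewrite leqnn andbT ltnW.
  by rewrite ugenN mul1r.
by exists i; first by rewrite i0 ltnW.
Qed.

(** This passes from a summand of [K_ij] to one of [M_ij] by [shift_prod_exchange]. With [a] and [b]
    arbitrary, it also serves the first bracket, where one of them is 1. *)
Lemma lS_normalized i j k a b n : (k <= i + j)%N ->
  a * lS (k%:Z - i%:Z) b n * shiftz n (P i)^-1 / P j
  = if n == k%:Z - i%:Z
    then a / P k * shiftz (k%:Z - i%:Z) (b / P (i + j - k)) else 0.
Proof.
move=> le_k; rewrite /lS; case: eqP => [->|]; last by rewrite mulr0 !mul0r.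
have Pu m : P m \is a GRing.unit by apply/shift_prod_unit/ugen1_unit.
have SPu m : shiftz (k%:Z - i%:Z) (P m) \is a GRing.unit by apply: rmorph_unit.
rewrite rmorphM !rmorphV //= -!mulrA; congr (_ * _).
rewrite [RHS]mulrCA; congr (_ * _); rewrite -!invrM //.
by rewrite -(shift_prod_exchange ugen1_unit le_k) mulrC.
Qed.

Lemma W_local_on (br : V -> V -> int -> V) (d : nat -> int -> F)
    (L : nat -> nat -> int -> V) :
  lambda_bracket br ->
  (forall i j, (0 < i < N)%N -> (0 < j < N)%N ->
     local_series (fun g => exists2 i, (0 < i < N)%N & g = v_elt iota i) (L i j)) ->
  (forall i j, (0 < i < N)%N -> (0 < j < N)%N -> forall n,
     br (u i) (u j) n * shiftz n (P i)^-1 / P j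
     = L i j n + (\sum_(k < i) d j (n + k%:Z)) *: (w j * shiftz n (w i))) ->
  (forall j, (0 < j < N)%N -> exists M : nat, forall n : int,
     (M < `|n|)%N -> \sum_(k < N) d j (n + k%:Z) = 0) ->
  local_on (A_alg iota) br.
Proof.
move=> brP L_loc br_u dN; apply: local_on_diffsubalg => // a b.
move=> [i0 /v_elt_normalized[i iN ->] ->] [j0 /v_elt_normalized[j jN ->] ->].
exact: (br_normalized_local N_gt1 ugen1_unit ugenN A_alg_normalized brP L_loc br_u dN).
Qed.

Lemma W_bracket1_local br : lambda_bracket br -> W_bracket1 iota br ->
  local_on (A_alg iota) br.
Proof.
(* The two terms are the cases [k = 0] and [k = i + j] of [lS_normalized], with 1 in place of the
   junk value [u_0]. *)
move=> brP br_gen; pose L i j n :=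
  (if n == 0%N%:Z - i%:Z then 1 * shiftz (0%N%:Z - i%:Z) (w (i + j)%N) else 0)
  - (if n == j%:Z then w (i + j)%N else 0).
apply: (@W_local_on br (fun _ _ => 0) L) => // [i j iN jN|i j iN jN n|j _].
- have w_in : A_alg iota (w (i + j)%N) by apply: A_alg_normalized; lia.
  apply: local_seriesD; last exact/local_seriesN/local_series_delta.
  by apply: local_series_delta; rewrite mul1r; apply: Dsub_shift.
- rewrite big1 // scale0r addr0 br_gen // /L !mulrBl; congr (_ - _).
    have := @lS_normalized i j 0 1 (u (i + j)%N) n (leq0n _).
    by rewrite mul1r sub0r subn0 /shift_prod big_ord0 divr1.
  have := @lS_normalized i j (i + j) (u (i + j)%N) 1 n (leqnn _).
  have -> : (i + j)%N%:Z - i%:Z = j by lia.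
  rewrite subnn /shift_prod big_ord0 divr1 rmorph1 mulr1 => <-.
  by rewrite /lS /lmono; case: ifP; rewrite ?rmorph1 ?mulr1 // mulr0.
- by exists 0%N => n _; rewrite big1.
Qed.

Lemma W_bracket2_local br : [pchar F] =i pred0 -> lambda_bracket br ->
  W_bracket2 iota br -> local_on (A_alg iota) br.
Proof.
move=> charF0 brP br_gen.
have [e [eP cE]] := W_ratfun_half_sum (ltnW N_gt1) charF0.
pose T i j k n := if n == k%:Z - i%:Z
  then w k * shiftz (k%:Z - i%:Z) (w (i + j - k)%N) else 0.
pose L i j n := \sum_(1 <= k < j.+1) T i j k n - \sum_(i <= k < i + j) T i j k n.
(* The series of [r_1j]; its sum over [k < i] telescopes to that of [r_ij]. *)
pose d j n := e (n - N%:Z) - e (n - j%:Z) - e (n - N%:Z + 1) + e (n - j%:Z + 1).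
have sum_d i j n : \sum_(k < i) d j (n + k%:Z)
    = e (n - N%:Z) - e (n - j%:Z) - e (n - N%:Z + i%:Z) + e (n - j%:Z + i%:Z).
  elim: i => [|i IH]; first by rewrite big_ord0 !addr0; ring.
  rewrite big_ord_recr /= IH /d !(addrAC n i%:Z) -!addrA.
  by rewrite -!PoszD !addn1; ring.
apply: (@W_local_on br d L) => // [i j iN jN|i j iN jN n|j jN].
- have T_loc k : (0 < k < i + j)%N -> local_series
      (fun g => exists2 i, (0 < i < N)%N & g = v_elt iota i) (T i j k).
    move=> kij; apply: local_series_delta; apply: Dsub_mul.
      by apply: A_alg_normalized; lia.
    by apply/Dsub_shift/A_alg_normalized; lia.
  apply: local_seriesD; last apply: local_seriesN.
    apply: eq_local_series => [n|]; first by rewrite big_nat_cond.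
    by apply: local_series_sum => k kj; apply: T_loc; lia.
  apply: eq_local_series => [n|]; first by rewrite big_nat_cond.
  by apply: local_series_sum => k kj; apply: T_loc; lia.
- have [c /cE c_e ->] := br_gen i j iN jN; rewrite sum_d -c_e.
  rewrite !mulrDl !mulNr; congr (_ - _ + _).
  + rewrite !mulr_suml; apply: eq_big_nat => k kj.
    by rewrite lS_normalized //; lia.
  + rewrite !mulr_suml; apply: eq_big_nat => k kj.
    by rewrite lS_normalized //; lia.
  + rewrite rmorphM /= -!scalerAr -!scalerAl; congr (_ *: _).
    by rewrite [RHS]mulrAC mulrA.
(* For [i = N] the sum is [1 - x^(j - N)]: away from [n = 0] and [n = j - N] the four values of [e]
   cancel in pairs. *)
- exists (N + j)%N => n lt_n; rewrite sum_d.
  have -> : n - N%:Z + N%:Z = n by lia.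
  have -> : n - j%:Z = n - j%:Z + N%:Z - N%:Z by lia.
  rewrite subrK.
  have e0 m : m != 0 -> e (m - N%:Z) = e m.
    by move=> /negPf m0; apply/eqP; rewrite -subr_eq0 eP m0.
  by rewrite !e0; [ring | lia..].
Qed.

End WGenerators.

Theorem theorem9p8 (F : fieldType) (charF0 : [pchar F] =i pred0)
    (N : nat) (N_ge3 : (3 <= N)%N)
    (V : diffAlg F) (iota : {lrmorphism diffpoly F N -> V})
    (V_loc : localized_diffpoly iota)
    (br1 br2 : V -> V -> int -> V)
    (br1_poisson : poisson_lambda_bracket br1)
    (br2_poisson : poisson_lambda_bracket br2)
    (br1_gen : W_bracket1 iota br1) (br2_gen : W_bracket2 iota br2) :
  local_on (A_alg iota) br1 /\ local_on (A_alg iota) br2.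
Proof.
have N_gt1 : (1 < N)%N := ltnW N_ge3.
split; first exact: W_bracket1_local br1_poisson br1_gen.
exact: W_bracket2_local charF0 br2_poisson br2_gen.
Qed.
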